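(* For every prime $p$, there exist rings $R_1,R_2,R_3,R_4$ (associative, not necessarily commutative or unital) such that \begin{itemize} \item $\eta_\ell(R_1)=\eta_r(R_1)=\eta(R_1)=p+1$, \item $\eta_\ell(R_2)=p+1$, whereas $\eta_r(R_2)=\eta(R_2)=\infty$, \item $\eta_r(R_3)=p+1$, whereas $\eta_\ell(R_3)=\eta(R_3)=\infty$, \item $\eta_\ell(R_4)=\eta_r(R_4)=p+1$, whereas $\eta(R_4)=\infty$. \end{itemize}
   Context: A ring is a set $R$ with binary operations $+$ and $\cdot$ such that $(R,+)$ is an abelian group, multiplication is associative, and both distributive laws hold; rings are not assumed to be commutative or to have a multiplicative identity. A left (resp. right) ideal of $R$ is an additive subgroup of $R$ closed under left (resp. right) multiplication by elements of $R$; a two-sided ideal is an additive subgroup that is both a left and a right ideal. An ideal is proper if it is not equal to $R$. For a ring $R$, the ideal covering numbers $\eta_\ell(R)$, $\eta_r(R)$, $\eta(R)$ are the minimal numbers of proper left, proper right, and proper two-sided ideals of $R$, respectively, whose union equals $R$; if no such (finite) cover exists, the corresponding number is defined to be $\infty$. *)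

(* Defs.v *)
From HB Require Import structures.
From mathcomp Require Import all_boot all_order all_algebra.
From mathcomp Require Import boolp classical_sets.

Set Implicit Arguments.
Unset Strict Implicit.
Unset Printing Implicit Defensive.

Import GRing.Theory.
Local Open Scope ring_scope.
Local Open Scope classical_set_scope.

(* MathComp's ring structures all have a unit, so associative rings that need
   not be unital or commutative are built directly on top of zmodType. *)
HB.mixin Record Zmodule_isRng R & GRing.Zmodule R := {
  rmul : R -> R -> R;
  rmulA : associative rmul;
  rmulDl : left_distributive rmul +%R;
  rmulDr : right_distributive rmul +%R
}.

#[short(type="rngType")]
HB.structure Definition Rng := { R of Zmodule_isRng R & GRing.Zmodule R }.

Section Ideals.
Variable R : rngType.
Implicit Type I : set R.

Definition left_ideal I : Prop :=
  zmod_closed [in I] /\ forall r x : R, I x -> I (rmul r x).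

Definition right_ideal I : Prop :=
  zmod_closed [in I] /\ forall r x : R, I x -> I (rmul x r).

Definition twosided_ideal I : Prop := left_ideal I /\ right_ideal I.

(* The family F may repeat an ideal; this does not affect the least n. *)
Definition coverable (ideal : set R -> Prop) (n : nat) : Prop :=
  exists F : 'I_n -> set R,
    (forall i, ideal (F i) /\ F i <> setT) /\ \bigcup_i F i = setT.

(* None stands for the value infinity. *)
Definition covering_number (ideal : set R -> Prop) : option nat :=
  if pselect (exists n, `[< coverable ideal n >]) is left ex_cover
  then Some (ex_minn ex_cover) else None.

End Ideals.

Definition eta_l (R : rngType) : option nat := covering_number (@left_ideal R).
Definition eta_r (R : rngType) : option nat := covering_number (@right_ideal R).
Definition eta (R : rngType) : option nat :=
  covering_number (@twosided_ideal R).

(* Main.v *)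
From HB Require Import structures.
Require Import Defs.
From mathcomp Require Import all_boot.
From mathcomp Require Import all_order all_algebra all_fingroup.
From mathcomp Require Import boolp classical_sets ring zify.

(** All four rings live on m x n matrices over F_p, with the Munn product
    (x o y)_ij = x_i0 * a * y_0j for a fixed scalar a.  Left multiplication
    rescales row 0, so if n = 2 the p+1 lines of F_p^2, pulled back along row 0,
    cover the ring by left ideals; transposition exchanges the two sides.  No
    smaller cover exists, since in a finite p-group a proper subgroup has index
    at least p and all subgroups share the identity.  If a = 1, the matrix unit
    E_00 lies in no proper two-sided ideal; when m = 1 it is a left identity, so
    it lies in no proper right ideal either.  If a = 0, every
    subgroup is an ideal.  Hence (m, n, a) = (1, 2, 0), (1, 2, 1), (2, 1, 1),
    (2, 2, 1) give R_1, R_2, R_3, R_4. *)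

Set Implicit Arguments.
Unset Strict Implicit.
Unset Printing Implicit Defensive.

Import GRing.Theory.
Local Open Scope ring_scope.

(** * Criteria for finite and infinite covering numbers *)

Section CoveringNumber.
Variable R : rngType.
Implicit Types ideal : set R -> Prop.

Lemma covering_numberSome ideal k :
  coverable ideal k -> (forall n, coverable ideal n -> (k <= n)%N) ->
  covering_number ideal = Some k.
Proof.
move=> cov_k min_k; rewrite /covering_number; case: pselect => [ex|[]]; last first.
  by exists k; apply/asboolP.
congr Some; case: ex_minnP => n /asboolP cov_n min_n.
by apply/eqP; rewrite eqn_leq min_n ?min_k //; apply/asboolP.
Qed.

(** In any cover, the member that contains [u] would fail to be proper. *)
Lemma covering_numberNone ideal (u : R) :
  (forall I, ideal I -> I u -> I = setT) -> covering_number ideal = None.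
Proof.
move=> idealT; rewrite /covering_number; case: pselect => // -[n cov_n].
exfalso; move/asboolP: cov_n => [F [idF covF]]; have : setT u by [].
rewrite -covF => -[i _ Fiu]; have [idFi properFi] := idF i.
by case: properFi; apply: idealT.
Qed.

End CoveringNumber.

Lemma eq_covering_number (R S : rngType) (idealR : set R -> Prop)
    (idealS : set S -> Prop) :
  (forall n, coverable idealR n <-> coverable idealS n) ->
  covering_number idealR = covering_number idealS.
Proof.
move=> eqRS; rewrite /covering_number.
by have -> : coverable idealR = coverable idealS by apply/funext => n; apply/propext.
Qed.

(** * Covers of finite p-groups by proper subgroups *)

Lemma pgroup_cover_gt (gT : finGroupType) (p n : nat) (H : 'I_n -> {group gT}) :
  prime p -> p.-nat #|[set: gT]| -> (forall i, H i \proper [set: gT]%G) ->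
  (forall x, exists i, x \in H i) -> (p < n)%N.
Proof.
move=> p_pr pG properH covH; rewrite ltnNge; apply/negP => le_np.
have p_gt1 := prime_gt1 p_pr.
have leH i : (p * #|H i| <= #|[set: gT]|)%N.
  have sHG := proper_sub (properH i).
  rewrite -(Lagrange sHG) mulnC leq_mul2l; apply/orP; right.
  have: #|[set: gT] : H i|%g != 1%N by rewrite indexg_eq1; case/andP: (properH i).
  have [[|k] ->] := p_natP (pnat_dvd (dvdn_indexg [set: gT]%G (H i)) pG) => // _.
  by rewrite expnS leq_pmulr // expn_gt0 ltnW.
(* Some member contains 1, so a proper subgroup exists and the trivial group is excluded. The bound
   [p <= #|G|] keeps the subtraction [#|G| - p] below from being truncated. *)
have [i0 _] := covH 1%g.
have G_ge_p : (p <= #|[set: gT]|)%N.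
  by apply: leq_trans (leH i0); rewrite leq_pmulr ?cardG_gt0.
have sub : ([set: gT] :\ 1%g \subset \bigcup_i (H i :\ 1%g)).
  apply/fintype.subsetP => x; rewrite !inE andbT => x1.
  by have [i Hix] := covH x; apply/bigcupP; exists i; rewrite // !inE x1.
have le_sum : (#|[set: gT] :\ 1%g| <= \sum_(i < n) #|(H i :\ 1%g)|)%N.
  apply: leq_trans (subset_leq_card sub) _.
  elim/big_rec2: _ => [|i k A _ le_Ak]; first by rewrite cards0.
  by rewrite (leq_trans (leq_card_setU _ _)) ?leq_add2l.
(* Each [H i] has at most [#|G| / p - 1] nonidentity elements; multiplying by [p] avoids the
   division. *)
have: (p * #|[set: gT] :\ 1%g| <= n * (#|[set: gT]| - p))%N.
  apply: leq_trans (leq_mul (leqnn p) le_sum) _.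
  rewrite big_distrr /= -[n in (n * _)%N]card_ord -sum_nat_const leq_sum // => i _.
  have := leH i; rewrite (cardsD1 1%g (H i)) group1 mulnDr muln1 => leHi.
  by rewrite leq_subRL.
(* With [#|G| = N + 1] and [n <= p], the right side is at most [p * (N + 1 - p)], which is less than
   [p * N] because [p > 1]. *)
rewrite (cardsD1 1%g [set: gT]) inE in G_ge_p *.
move: le_np p_gt1 G_ge_p; move: #|_ :\ _| => N.
nia.
Qed.

Local Open Scope classical_set_scope.

Lemma zmod_closed_setP (V : zmodType) (I : set V) :
  zmod_closed [in I] <-> I 0 /\ forall x y, I x -> I y -> I (x - y).
Proof.
split=> -[I0 IB]; split=> [|x y Ix Iy]; try by apply: mem_set.
- exact: set_mem I0.
- exact: set_mem (IB x y (mem_set Ix) (mem_set Iy)).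
- by apply: mem_set; apply: IB; apply: set_mem.
Qed.

Lemma pgroup_subgroup_cover_gt (V : finZmodType) (p k n : nat) (F : 'I_n -> set V) :
  prime p -> #|V| = (p ^ k)%N ->
  (forall i, zmod_closed [in F i] /\ F i <> setT) ->
  \bigcup_i F i = setT -> (p < n)%N.
Proof.
move=> p_pr cardV subF covF.
pose G i : {set V} := [set x | x \in F i]%SET.
have groupG i : group_set (G i).
  have [/zmod_closed_setP[F0 FB] _] := subF i.
  apply/group_setP; split=> [|x y].
    by rewrite finset.in_set; apply: mem_set.
  rewrite !finset.in_set => /set_mem Fx /set_mem Fy; apply: mem_set.
  (* The group law of a [finZmodType] is its addition, while [FB] only gives closure under
     subtraction. *)
  have -> : (x * y)%g = x - (0 - y) by rewrite sub0r opprK.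
  by apply: (FB) => //; apply: (FB).
apply: (@pgroup_cover_gt V p n (fun i => Group (groupG i))) => //=.
- by rewrite cardsT cardV pnatX pnat_id.
- move=> i; rewrite properE finset.subsetT /=; apply/negP => /fintype.subsetP sTG.
  have [_ []] := subF i; apply/seteqP; split=> // x _.
  by have := sTG x; rewrite !finset.in_set => /(_ isT) /set_mem.
- move=> x; have : setT x by [].
  by rewrite -covF => -[i _ Fx]; exists i; rewrite finset.in_set; apply: mem_set.
Qed.

(* The indices are shifted: [munn a m n] has [m + 1] rows and [n + 1] columns. *)
Definition munn (K : fieldType) (a : K) (m n : nat) : Type := 'M[K]_(m.+1, n.+1).

(** * The Munn product and its behaviour under transposition *)

Section Munn.
Variables (K : fieldType) (a : K) (m n : nat).

HB.instance Definition _ := GRing.Zmodule.on (munn a m n).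

(** This is [x P y] with sandwich matrix [P = a E_00]. The type carries [a] as a phantom parameter
    so that each scalar gets its own ring structure. *)
Definition munn_mul (x y : munn a m n) : munn a m n :=
  \matrix_(i, j) (x i 0 * a * y 0 j).

Fact munn_mulA : associative munn_mul.
Proof. by move=> x y z; apply/matrixP => i j; rewrite !mxE; ring. Qed.

Fact munn_mulDl : left_distributive munn_mul +%R.
Proof. by move=> x y z; apply/matrixP => i j; rewrite !mxE; ring. Qed.

Fact munn_mulDr : right_distributive munn_mul +%R.
Proof. by move=> x y z; apply/matrixP => i j; rewrite !mxE; ring. Qed.

HB.instance Definition _ :=
  Zmodule_isRng.Build (munn a m n) munn_mulA munn_mulDl munn_mulDr.

Lemma munnE (x y : munn a m n) i j : rmul x y i j = x i 0 * a * y 0 j.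
Proof. by rewrite mxE. Qed.

End Munn.

(** Transposition is thus an anti-isomorphism between [munn a m n] and [munn a n m], which exchanges
    left and right ideals. *)
Lemma trmx_munn_mul (K : fieldType) (a : K) m n (x y : munn a m n) :
  (rmul x y)^T = rmul (y^T : munn a n m) (x^T : munn a n m).
Proof. by apply/matrixP => i j; rewrite !mxE; ring. Qed.

Lemma zmod_closed_trmx (K : fieldType) (a : K) m n (I : set (munn a m n)) :
  zmod_closed [in I] ->
  zmod_closed [in [set x : munn a n m | I (x^T : munn a m n)]].
Proof.
move=> /zmod_closed_setP[I0 IB]; apply/zmod_closed_setP.
by split=> [|x y Ix Iy] /=; rewrite ?trmx0 ?linearB //; apply: IB.
Qed.

Lemma left_ideal_trmx (K : fieldType) (a : K) m n (I : set (munn a m n)) :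
  right_ideal I -> left_ideal [set x : munn a n m | I (x^T : munn a m n)].
Proof.
move=> [zI rI]; split=> [|r x Ix /=]; first exact: zmod_closed_trmx.
by rewrite trmx_munn_mul; apply: rI.
Qed.

Lemma right_ideal_trmx (K : fieldType) (a : K) m n (I : set (munn a m n)) :
  left_ideal I -> right_ideal [set x : munn a n m | I (x^T : munn a m n)].
Proof.
move=> [zI lI]; split=> [|r x Ix /=]; first exact: zmod_closed_trmx.
by rewrite trmx_munn_mul; apply: lI.
Qed.

Lemma coverable_trmx (K : fieldType) (a : K) m n
    (idealR : set (munn a m n) -> Prop) (idealS : set (munn a n m) -> Prop) k :
  (forall I, idealR I -> idealS [set x : munn a n m | I (x^T : munn a m n)]) ->
  coverable idealR k -> coverable idealS k.
Proof.
move=> idealRS [F [idF covF]].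
exists (fun i => [set x : munn a n m | F i (x^T : munn a m n)]); split=> [i|].
  have [idFi properFi] := idF i; split; first exact: idealRS.
  move=> FT; apply: properFi; apply/seteqP; split=> // x _.
  by have : setT (x^T : munn a n m) by []; rewrite -FT /= trmxK.
apply/seteqP; split=> // x _; have : setT (x^T : munn a m n) by [].
by rewrite -covF => -[i _ Fx]; exists i.
Qed.

Lemma eta_r_munn (K : fieldType) (a : K) m n :
  eta_r (munn a m n) = eta_l (munn a n m).
Proof.
apply: eq_covering_number => k; split; apply: coverable_trmx.
  exact: left_ideal_trmx.
exact: right_ideal_trmx.
Qed.

(** * The cover by lines and the finite covering numbers *)

Section Cover.
Variables (K : finFieldType) (a : K) (m n : nat).
Local Notation R := (munn a m n.+1).

(** [option K] indexes the projective line over [K]: [Some c] is the line of slope [c], [None] the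
    vertical line, in the coordinates given by the first and last entries of row 0. *)
Definition line_ideal (s : option K) : set R :=
  [set x : R | if s is Some c then x 0 ord_max = c * x 0 0 else x 0 0 = 0].

Lemma line_ideal_zmod_closed s : zmod_closed [in line_ideal s].
Proof.
apply/zmod_closed_setP; split=> [|x y].
  by case: s => [c|] /=; rewrite !mxE ?mulr0.
by case: s => [c|] /=; rewrite !mxE => -> ->; ring.
Qed.

Lemma line_ideal_left s : left_ideal (line_ideal s).
Proof.
split=> [|r x]; first exact: line_ideal_zmod_closed.
by case: s => [c|] /=; rewrite !munnE => ->; ring.
Qed.

Lemma line_ideal_proper s : line_ideal s <> setT.
Proof.
(* The matrix unit [E_0j] lies off the line: [j] is the last column for a finite slope and column 0
   for the vertical line. *)
move=> LT; pose j := if s is Some _ then ord_max else 0 : 'I_n.+2.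
have : setT (delta_mx 0 j : R) by [].
rewrite -LT /j; case: s {LT j} => [c|] /=; rewrite !mxE !eqxx /= ?mulr0;
  by move/eqP; rewrite oner_eq0.
Qed.

Lemma line_ideal_cover (x : R) : exists s, line_ideal s x.
Proof.
have [x0|x0] := eqVneq (x 0 0) 0; first by exists None.
by exists (Some (x 0 ord_max / x 0 0)); rewrite /= divfK.
Qed.

Lemma coverable_line_ideal (ideal : set R -> Prop) :
  (forall s, ideal (line_ideal s)) -> coverable ideal #|K|.+1.
Proof.
rewrite -card_option => idealL.
exists (fun i => line_ideal (enum_val i)); split=> [i|].
  by split; [exact: idealL | exact: line_ideal_proper].
apply/seteqP; split=> // x _; have [s Ls] := line_ideal_cover x.
by exists (enum_rank s); rewrite // enum_rankK.
Qed.

End Cover.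

Lemma line_ideal_right (K : finFieldType) m n (s : option K) :
  right_ideal (@line_ideal K 0 m n s).
Proof.
split=> [|r x _]; first exact: line_ideal_zmod_closed.
by case: s => [c|] /=; rewrite !munnE; ring.
Qed.

Lemma coverable_munn_gt (K : finFieldType) (a : K) m n
    (ideal : set (munn a m n) -> Prop) k :
  prime #|K| -> (forall I, ideal I -> zmod_closed [in I]) ->
  coverable ideal k -> (#|K| < k)%N.
Proof.
move=> K_pr zideal [F [idF covF]].
apply: (@pgroup_subgroup_cover_gt 'M[K]_(m.+1, n.+1) _ (m.+1 * n.+1) _ F) => //.
  by rewrite card_mx.
by move=> i; have [idFi properFi] := idF i; split; [exact: zideal|].
Qed.

Lemma eta_l_munn (K : finFieldType) (a : K) m n :
  prime #|K| -> eta_l (munn a m n.+1) = Some #|K|.+1.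
Proof.
move=> K_pr; apply: covering_numberSome => [|k].
  by apply: coverable_line_ideal => s; exact: line_ideal_left.
by apply: coverable_munn_gt => // I [].
Qed.

Lemma eta_munn0 (K : finFieldType) m n :
  prime #|K| -> eta (munn (0 : K) m n.+1) = Some #|K|.+1.
Proof.
move=> K_pr; apply: covering_numberSome => [|k].
  apply: coverable_line_ideal => s.
  by split; [exact: line_ideal_left | exact: line_ideal_right].
by apply: coverable_munn_gt => // I [[]].
Qed.

Lemma eta_r_munn0 (K : finFieldType) m n :
  prime #|K| -> eta_r (munn (0 : K) m n.+1) = Some #|K|.+1.
Proof.
move=> K_pr; apply: covering_numberSome => [|k].
  by apply: coverable_line_ideal => s; exact: line_ideal_right.
by apply: coverable_munn_gt => // I [].
Qed.

(** * Infinite covering numbers when [a = 1] *)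

Lemma eta_r_munn1_row (K : fieldType) n : eta_r (munn (1 : K) 0 n) = None.
Proof.
apply: (@covering_numberNone _ _ (delta_mx 0 0 : munn (1 : K) 0 n)).
move=> I [_ rI] Iu; apply/seteqP; split=> // y _.
have <- : rmul (delta_mx 0 0 : munn (1 : K) 0 n) y = y; last exact: rI.
by apply/matrixP => i j; rewrite munnE ord1 mxE !eqxx !mul1r.
Qed.

(** The factorization [y_ij E_ij = (y_ij E_i0) o (E_00 o E_0j)] puts every summand of [y] in any
    two-sided ideal containing [E_00]. *)
Lemma eta_munn1 (K : fieldType) m n : eta (munn (1 : K) m n) = None.
Proof.
apply: (@covering_numberNone _ _ (delta_mx 0 0 : munn (1 : K) m n)).
move=> I [[/zmod_closed_setP[I0 IB] lI] [_ rI]] Iu; apply/seteqP; split=> // y _.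
have ID x z : I x -> I z -> I (x + z).
  move=> Ix Iz; have -> : x + z = x - (0 - z) by rewrite sub0r opprK.
  by apply: (IB) => //; apply: (IB).
rewrite (matrix_sum_delta y).
apply: (big_ind I) => [||i _]; [exact: I0 | exact: ID |].
apply: (big_ind I) => [||j _]; [exact: I0 | exact: ID |].
have -> : y i j *: delta_mx i j =
    rmul (y i j *: delta_mx i 0 : munn (1 : K) m n)
      (rmul (delta_mx 0 0 : munn (1 : K) m n) (delta_mx 0 j)).
  apply/matrixP => i' j'; rewrite !munnE !mxE !eqxx /=.
  by rewrite andbT !mulr1 mul1r -mulrA -natrM mulnb.
by apply: lI; apply: rI.
Qed.

Theorem theorem1p1 (p : nat) (p_prime : prime p) :
  exists R1 R2 R3 R4 : rngType,
    [/\ [/\ eta_l R1 = Some p.+1, eta_r R1 = Some p.+1 & eta R1 = Some p.+1],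
        [/\ eta_l R2 = Some p.+1, eta_r R2 = None & eta R2 = None],
        [/\ eta_r R3 = Some p.+1, eta_l R3 = None & eta R3 = None]
      & [/\ eta_l R4 = Some p.+1, eta_r R4 = Some p.+1 & eta R4 = None]].
Proof.
pose K : finFieldType := 'F_p.
have cardK : #|K| = p := card_Fp p_prime.
have K_prime : prime #|K| by rewrite cardK.
exists (munn (0 : K) 0 1), (munn (1 : K) 0 1).
exists (munn (1 : K) 1 0), (munn (1 : K) 1 1).
rewrite -cardK !eta_munn1; split; split=> //.
- exact: eta_l_munn.
- exact: eta_r_munn0.
- exact: eta_munn0.
- exact: eta_l_munn.
- exact: eta_r_munn1_row.
(* [R_3] is the transpose of [R_2], and [R_4] is its own transpose, so their remaining values come
   from the other side. *)
- by rewrite eta_r_munn eta_l_munn.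
- by rewrite -eta_r_munn eta_r_munn1_row.
- exact: eta_l_munn.
- by rewrite eta_r_munn eta_l_munn.
Qed.
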